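(* Let $G$ be a connected graph on $n$ vertices, with resistance Laplacian $\mathcal{R}$, Moore--Penrose inverse $L^\dagger$ of its Laplacian, average resistance centrality $\bar d$, and resistance deviation operator $T=\Delta P+P\Delta-\Delta$. Then \[ \mathcal{R}=2L^\dagger+2n\bar d\,P+nT . \]
   Context: $G=(V,E)$ is a finite, simple, connected, undirected, unweighted graph with vertex set $V=\{1,\dots,n\}$. $L=D_G-A$ is its combinatorial Laplacian (degree matrix minus adjacency matrix). $\mathbf 1\in\mathbb R^n$ is the all-ones vector, $I$ the identity matrix, $J=\mathbf 1\mathbf 1^\top$, $P=I-\frac1n J$ (orthogonal projection onto $\mathbf 1^\perp$). $L^\dagger$ is the Moore--Penrose inverse of $L$, i.e. the unique symmetric matrix with $LL^\dagger=L^\dagger L=I-\frac1n\mathbf 1\mathbf 1^\top$ and $L^\dagger\mathbf 1=\mathbf 0$. The effective resistance between $i$ and $j$ is $r_{ij}=(L^\dagger)_{ii}+(L^\dagger)_{jj}-2(L^\dagger)_{ij}$, the resistance matrix is $R=(r_{ij})_{1\le i,j\le n}$, and the resistance Laplacian is $\mathcal R=\operatorname{diag}(R\mathbf 1)-R$. Put $d_i=(L^\dagger)_{ii}$, $D=\operatorname{diag}(d_1,\dots,d_n)$, $\bar d=\frac1n\operatorname{tr}(L^\dagger)$ (average resistance centrality), $\Delta=D-\bar d I$ (resistance deviation matrix). The resistance deviation operator is the matrix $T=\Delta P+P\Delta-\Delta$. *)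

(* Defs.v *)
From HB Require Import structures.
From mathcomp Require Import all_boot all_order all_algebra.

Set Implicit Arguments.
Unset Strict Implicit.
Unset Printing Implicit Defensive.

Import Order.TTheory GRing.Theory Num.Theory.
Local Open Scope ring_scope.

(* The four Penrose equations; over a real field the conjugate transpose is
   the transpose. *)
Definition penrose (R : realFieldType) (m n : nat)
    (A : 'M[R]_(m, n)) (X : 'M[R]_(n, m)) : bool :=
  [&& A *m X *m A == A, X *m A *m X == X,
      (A *m X)^T == A *m X & (X *m A)^T == X *m A].

Lemma mulmx_tr_eq0 (R : realFieldType) (n : nat) (v : 'rV[R]_n) :
  v *m v^T = 0 -> v = 0.
Proof.
move=> /matrixP/(_ 0 0); rewrite !mxE => /eqP h.
apply/rowP => j; rewrite mxE; move: h.
rewrite psumr_eq0 => [/allP/(_ j)|i _]; rewrite !mxE -?expr2 ?sqr_ge0 //.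
by rewrite mem_index_enum sqrf_eq0 => /(_ isT)/eqP.
Qed.

Lemma gram_unitmx (R : realFieldType) (r n : nat) (B : 'M[R]_(r, n)) :
  row_free B -> B *m B^T \in unitmx.
Proof.
move=> freeB; rewrite -row_free_unit; apply/inj_row_free => v vBB0.
apply/eqP; rewrite -(mulmx_free_eq0 v freeB); apply/eqP/mulmx_tr_eq0.
by rewrite trmx_mul mulmxA -(mulmxA v) vBB0 mul0mx.
Qed.

Lemma penrose_exists (R : realFieldType) (m n : nat) (A : 'M[R]_(m, n)) :
  exists X, penrose A X.
Proof.
have [r [B [C [freeB freeC defA]]]] : exists r (B : 'M[R]_(r, n))
    (C : 'M[R]_(m, r)), [/\ row_free B, row_free C^T & C *m B = A].
  exists (\rank A), (row_base A), (col_base A); split; rewrite ?row_base_free ?mulmx_base //.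
  by rewrite /row_free mxrank_tr; have := col_base_full A.
have uB := gram_unitmx freeB; have uC := gram_unitmx freeC.
rewrite trmxK in uC; set S := B *m B^T in uB; set Q := C^T *m C in uC.
have symS : (invmx S)^T = invmx S by rewrite trmx_inv /S trmx_mul trmxK.
have symQ : (invmx Q)^T = invmx Q by rewrite trmx_inv /Q trmx_mul trmxK.
pose X := B^T *m invmx S *m (invmx Q *m C^T).
have AX : A *m X = C *m invmx Q *m C^T.
  by rewrite -defA /X -!mulmxA (mulmxA B) -/S (mulKVmx uB).
have XA : X *m A = B^T *m invmx S *m B.
  by rewrite -defA /X -!mulmxA (mulmxA C^T) -/Q (mulKmx uC).
exists X; apply/and4P; split; apply/eqP.
- by rewrite AX -defA -!mulmxA (mulmxA C^T) -/Q (mulKmx uC).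
- by rewrite XA /X -!mulmxA (mulmxA B) -/S (mulKVmx uB).
- by rewrite AX !trmx_mul trmxK symQ mulmxA.
- by rewrite XA !trmx_mul trmxK symS mulmxA.
Qed.

Lemma penrose_unique (R : realFieldType) (m n : nat) (A : 'M[R]_(m, n))
    (X Y : 'M[R]_(n, m)) : penrose A X -> penrose A Y -> X = Y.
Proof.
case/and4P=> /eqP X1 /eqP X2 /eqP X3 /eqP X4.
case/and4P=> /eqP Y1 /eqP Y2 /eqP Y3 /eqP Y4.
have eqAX : A *m X = A *m Y.
  by rewrite -X3 -{1}Y1 -mulmxA trmx_mul X3 Y3 mulmxA X1.
have eqXA : X *m A = Y *m A.
  by rewrite -X4 -{1}Y1 -[A *m Y *m A]mulmxA mulmxA trmx_mul X4 Y4
             -mulmxA (mulmxA A) X1.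
by rewrite -X2 eqXA -mulmxA eqAX mulmxA Y2.
Qed.

Definition mpinv (R : realFieldType) (m n : nat) (A : 'M[R]_(m, n)) :
  'M[R]_(n, m) := xchoose (penrose_exists A).

Lemma mpinvP (R : realFieldType) (m n : nat) (A : 'M[R]_(m, n)) :
  penrose A (mpinv A).
Proof. exact: xchooseP. Qed.

(* A simple graph on the vertex set 'I_n is given by its adjacency relation. *)
Definition simple_graph (n : nat) (e : rel 'I_n) : Prop :=
  symmetric e /\ irreflexive e.

Definition connected_graph (n : nat) (e : rel 'I_n) : Prop :=
  forall i j : 'I_n, connect e i j.

Definition adjacency (R : realFieldType) (n : nat) (e : rel 'I_n) : 'M[R]_n :=
  \matrix_(i, j) (e i j)%:R.

Definition degree (n : nat) (e : rel 'I_n) (i : 'I_n) : nat :=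
  #|[set j | e i j]|.

Definition laplacian (R : realFieldType) (n : nat) (e : rel 'I_n) : 'M[R]_n :=
  diag_mx (\row_i (degree e i)%:R) - adjacency R e.

Definition lap_pinv (R : realFieldType) (n : nat) (e : rel 'I_n) : 'M[R]_n :=
  mpinv (laplacian R e).

Definition ones (R : realFieldType) (n : nat) : 'cV[R]_n := const_mx 1.

Definition Jmx (R : realFieldType) (n : nat) : 'M[R]_n :=
  ones R n *m (ones R n)^T.

Definition Pmx (R : realFieldType) (n : nat) : 'M[R]_n :=
  1%:M - n%:R^-1 *: Jmx R n.

Definition eff_res (R : realFieldType) (n : nat) (e : rel 'I_n)
    (i j : 'I_n) : R :=
  lap_pinv R e i i + lap_pinv R e j j - 2 * lap_pinv R e i j.

Definition resistance_mx (R : realFieldType) (n : nat) (e : rel 'I_n) :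
  'M[R]_n := \matrix_(i, j) eff_res R e i j.

Definition resistance_laplacian (R : realFieldType) (n : nat) (e : rel 'I_n) :
    'M[R]_n :=
  diag_mx (resistance_mx R e *m ones R n)^T - resistance_mx R e.

Definition avg_res_centrality (R : realFieldType) (n : nat) (e : rel 'I_n) : R :=
  n%:R^-1 * \tr (lap_pinv R e).

Definition res_deviation_mx (R : realFieldType) (n : nat) (e : rel 'I_n) :
    'M[R]_n :=
  diag_mx (\row_i lap_pinv R e i i) - avg_res_centrality R e *: 1%:M.

Definition res_deviation_op (R : realFieldType) (n : nat) (e : rel 'I_n) :
    'M[R]_n :=
  res_deviation_mx R e *m Pmx R n + Pmx R n *m res_deviation_mx R e
  - res_deviation_mx R e.

(* Main.v *)
Require Import Defs.
From HB Require Import structures.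
From mathcomp Require Import all_boot all_order all_algebra.
From mathcomp Require Import ring.

Set Implicit Arguments.
Unset Strict Implicit.
Unset Printing Implicit Defensive.

Import Order.TTheory GRing.Theory Num.Theory.
Local Open Scope ring_scope.

(** Write [M] for the pseudoinverse of the Laplacian, [d_i] for its diagonal
    entries and [a] for their mean.  The graph enters the identity through
    one fact, that the rows of [M] sum to zero: the Laplacian is symmetric and
    kills the all-ones vector, and a pseudoinverse kills the kernel of the
    transpose ([mpinv_ker_tr], [lap_pinv_ones]).  Summing
    [r_ij = d_i + d_j - 2 M_ij] over [j], the last term therefore vanishes and
    the [i]-th row sum of the resistance matrix is [n (d_i + a)]
    ([resistance_mx_ones]).  The [(i, j)] entry of the resistance Laplacian is
    thus [n (d_i + a) delta_ij - d_i - d_j + 2 M_ij].  On the other side, the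
    deviation operator has the entry
    [(d_i - a) delta_ij - (d_i + d_j - 2 a) / n] ([res_deviation_opE]).  After
    multiplication by [n], its mean terms [- n a delta_ij + 2 a] combine with the
    entry [2 n a delta_ij - 2 a] of [2 n a P] to leave [n a delta_ij], and the
    two sides agree. *)

(** Since [X = X (A X)] and [A X] is symmetric, [X = X X^T A^T], so [X] kills
    whatever [A^T] kills. *)
Lemma mpinv_ker_tr (R : realFieldType) (m n p : nat) (A : 'M[R]_(m, n))
    (v : 'M[R]_(m, p)) : A^T *m v = 0 -> mpinv A *m v = 0.
Proof.
move=> Av0; have /and4P[_ /eqP XAX /eqP symAX _] := mpinvP A.
by rewrite -XAX -[X in X *m v]mulmxA -symAX trmx_mul -!mulmxA Av0 !mulmx0.
Qed.

Lemma laplacian_sym (R : realFieldType) (n : nat) (e : rel 'I_n) :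
  symmetric e -> (laplacian R e)^T = laplacian R e.
Proof.
move=> sym_e; rewrite /laplacian raddfB /= tr_diag_mx; congr (_ - _).
by apply/matrixP=> i j; rewrite !mxE sym_e.
Qed.

Lemma laplacian_ones (R : realFieldType) (n : nat) (e : rel 'I_n) :
  laplacian R e *m ones R n = 0.
Proof.
apply/matrixP=> i j; rewrite mulmxBl mul_diag_mx !mxE mulr1.
under eq_bigr => k _ do rewrite !mxE mulr1.
by rewrite -natr_sum -big_mkcond /= sum1dep_card subrr.
Qed.

Lemma lap_pinv_ones (R : realFieldType) (n : nat) (e : rel 'I_n) :
  symmetric e -> lap_pinv R e *m ones R n = 0.
Proof.
by move=> sym_e; apply: mpinv_ker_tr; rewrite laplacian_sym // laplacian_ones.
Qed.

Lemma resistance_mx_ones (R : realFieldType) (n : nat) (e : rel 'I_n)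
    (i : 'I_n) : (0 < n)%N -> symmetric e ->
  (resistance_mx R e *m ones R n) i 0 =
    n%:R * (lap_pinv R e i i + avg_res_centrality R e).
Proof.
move=> n_gt0 sym_e.
have n_neq0 : n%:R != 0 :> R by rewrite pnatr_eq0 -lt0n.
have row_sum0 : \sum_j lap_pinv R e i j = 0.
  have /matrixP/(_ i 0) := lap_pinv_ones R sym_e; rewrite !mxE => row_i.
  by rewrite -[RHS]row_i; apply: eq_bigr => j _; rewrite mxE mulr1.
rewrite mxE; under eq_bigr => j _ do rewrite !mxE mulr1.
rewrite sumrB big_split /= -mulr_sumr row_sum0 sumr_const card_ord.
by rewrite mulr0 subr0 mulrDr mulrA divff // mul1r mulr_natl.
Qed.

Lemma PmxE (R : realFieldType) (n : nat) (i j : 'I_n) :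
  Pmx R n i j = (i == j)%:R - n%:R^-1.
Proof. by rewrite !mxE big_ord1 !mxE !mulr1. Qed.

Lemma res_deviation_mxE (R : realFieldType) (n : nat) (e : rel 'I_n) :
  res_deviation_mx R e =
    diag_mx (\row_i (lap_pinv R e i i - avg_res_centrality R e)).
Proof.
by apply/matrixP=> i j; rewrite !mxE mulr_natr -mulrnBl.
Qed.

Lemma res_deviation_opE (R : realFieldType) (n : nat) (e : rel 'I_n)
    (i j : 'I_n) :
  res_deviation_op R e i j =
    (lap_pinv R e i i - avg_res_centrality R e) * (i == j)%:R
    - n%:R^-1 * (lap_pinv R e i i + lap_pinv R e j j
                 - 2 * avg_res_centrality R e).
Proof.
rewrite /res_deviation_op res_deviation_mxE mul_diag_mx mul_mx_diag.
rewrite !mxE !big_ord1 !mxE.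
by case: eqVneq => [->|_]; rewrite ?mulr1n ?mulr0n /=; ring.
Qed.

Theorem theorem2p4 (R : realFieldType) (n : nat) (e : rel 'I_n)
    (n_gt0 : (0 < n)%N) (simple_e : simple_graph e)
    (connected_e : connected_graph e) :
  resistance_laplacian R e =
    2 *: lap_pinv R e
    + (2 * n%:R * avg_res_centrality R e) *: Pmx R n
    + n%:R *: res_deviation_op R e.
Proof.
have [sym_e _] := simple_e.
have n_neq0 : n%:R != 0 :> R by rewrite pnatr_eq0 -lt0n.
apply/matrixP=> i j.
have -> : resistance_laplacian R e i j =
    (resistance_mx R e *m ones R n) i 0 * (i == j)%:R - eff_res R e i j.
  by rewrite mulr_natr /resistance_laplacian !mxE.
rewrite resistance_mx_ones // /eff_res.
have -> (A B C : 'M[R]_n) (a b c : R) :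
    (a *: A + b *: B + c *: C) i j = a * A i j + b * B i j + c * C i j.
  by rewrite !mxE.
by rewrite PmxE res_deviation_opE; field.
Qed.
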